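(* For all $p$ with $1\le p\le\log n$, there is a $(2p-1)$-pass streaming algorithm for \textsc{sink-find-t} that uses $O(n^{1/p}\log(3p))$ space and has failure probability at most $1/3$.
   Context: Input: an $n$-vertex tournament (exactly one directed edge between each pair of distinct vertices) presented as a stream of edges in arbitrary order. \textsc{sink-find-t}: under the promise that the input is an acyclic tournament, output a sink (vertex with no outgoing edges). *)

(* Defs.v *)
From HB Require Import structures.
From mathcomp Require Import all_boot all_order all_algebra.
From mathcomp Require Import all_classical all_reals all_analysis.

Set Implicit Arguments.
Unset Strict Implicit.
Unset Printing Implicit Defensive.

Import Order.TTheory GRing.Theory Num.Theory.
Local Open Scope ring_scope.

Definition log2 (R : realType) (x : R) : R := ln x / ln 2.

(** ** Digraphs on the vertex set ['I_n], given by their edge relation *)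

Definition tournament (n : nat) (e : rel 'I_n) : Prop :=
  irreflexive e /\ forall u v : 'I_n, u != v -> e u v (+) e v u.

(* In MathComp, [cycle e [::]] holds; a nonempty [c] with [cycle e c] is a
   closed directed walk, possibly of length 1 or 2. *)
Definition acyclic (n : nat) (e : rel 'I_n) : Prop :=
  forall c : seq 'I_n, cycle e c -> c = [::].

Definition sink (n : nat) (e : rel 'I_n) (u : 'I_n) : bool :=
  [forall v, ~~ e u v].

(* Every edge occurs exactly once; the order is otherwise unconstrained. *)
Definition edge_stream (n : nat) (e : rel 'I_n) (s : seq ('I_n * 'I_n)) : Prop :=
  uniq s /\ forall u v : 'I_n, ((u, v) \in s) = e u v.

(** ** Randomized multi-pass streaming algorithms *)

(* The memory is an array of [k] words of [ceil (log2 n)] bits each, which is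
   what it takes to store one vertex. *)
Definition word (n : nat) : Type := (up_log 2 n).-tuple bool.
Definition memory (n k : nat) : Type := k.-tuple (word n).

(* The only information that survives from one stream item to the next is the
   content of the memory; in particular neither the position in the stream, nor
   the number of the current pass, nor past coins are available for free.
   [step] is called with [None] at the start of each pass, and with [Some x]
   when the item [x] is read; each call gets a fresh independent coin, uniformly
   distributed over the finite set [coin]. *)
Record stream_alg (n k : nat) (item out : Type) := StreamAlg {
  coin : finType;
  coin_gt0 : (0 < #|coin|)%N;
  init : memory n k;
  step : coin -> memory n k -> option item -> memory n k;
  output : memory n k -> out
}.

Definition passes (item : Type) (q : nat) (s : seq item) : seq (option item) :=
  flatten (nseq q (None :: map Some s)).

Definition run (n k : nat) (item out : Type) (A : stream_alg n k item out)
    (t : seq (option item)) (cs : seq (coin A)) : out :=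
  output A (foldl (fun m xc => step xc.2 m xc.1) (init A) (zip t cs)).

Definition failure_prob (R : realType) (n k : nat) (item out : Type)
    (A : stream_alg n k item out) (q : nat) (s : seq item) (good : pred out) : R :=
  let T := size (passes q s) in
  #|[set cs : T.-tuple (coin A) | ~~ good (run (passes q s) cs)]|%:R
    / #|{: T.-tuple (coin A)}|%:R.

(* [A] is a [q]-pass algorithm for SINK-FIND-T on [n] vertices with failure
   probability at most [delta]. *)
Definition solves_sink_find_t (R : realType) (n k q : nat)
    (A : stream_alg n k ('I_n * 'I_n) 'I_n) (delta : R) : Prop :=
  forall (e : rel 'I_n) (s : seq ('I_n * 'I_n)),
    tournament e -> acyclic e -> edge_stream e s ->
    failure_prob R A q s (sink e) <= delta.

(* Main.v *)
(* In an acyclic tournament, the outdegree is injective and decreases along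
   edges, so the out-neighbours of a vertex of outdegree d have outdegrees
   0, ..., d-1, and the sink is the vertex of outdegree 0. Odd passes compute the
   outdegrees of m sampled vertices and keep the vertex v of least outdegree d;
   as d is then known, m uniform positions in the list of out-neighbours of v can
   be drawn at once, and the next pass reads off the corresponding vertices. With
   Q about n^(1/p), each sampling round divides the least outdegree by Q except
   with probability (1 - 1/Q)^m <= 1/(3p), so p rounds bring it below n/Q^p <= 1. *)
Require Import Defs.
From HB Require Import structures.
From mathcomp Require Import all_boot all_order all_algebra.
From mathcomp Require Import all_classical all_reals all_analysis.
From mathcomp Require Import lra zify.

Set Implicit Arguments.
Unset Strict Implicit.
Unset Printing Implicit Defensive.

Import Order.TTheory GRing.Theory Num.Theory.
Local Open Scope ring_scope.

(** * Failure probability, one coin at a time *)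

Section BadProbability.
Context (R : realType) (coin : finType) (M X : Type).
Context (step : coin -> M -> X -> M) (bad : pred M).

(** Averaging over the next coin at each item lets a pass be analysed conditionally on the memory it
    starts from; [bad_probE] links this to the count of coin tuples. *)
Fixpoint bad_prob (t : seq X) (m : M) : R :=
  if t is x :: t' then (\sum_c bad_prob t' (step c m x)) / #|coin|%:R
  else (bad m)%:R.

Lemma card_tuple_cons (k : nat) (P : pred (k.+1.-tuple coin)) :
  #|[set cs | P cs]| = (\sum_c #|[set cs : k.-tuple coin | P (cons_tuple c cs)]|)%N.
Proof.
rewrite -sum1_card.
rewrite (reindex (fun x : coin * k.-tuple coin => (cons_tuple x.1 x.2))) /=; last first.
  exists (fun cs : k.+1.-tuple coin => (thead cs, behead_tuple cs)) => [[c cs] _|cs _] /=.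
    by congr (_, _); apply/val_inj.
  by rewrite [RHS]tuple_eta; apply/val_inj.
rewrite (eq_bigl (fun x => predT x.1 && P (cons_tuple x.1 x.2))); last first.
  by move=> [c cs]; rewrite inE.
rewrite -(pair_big_dep predT (fun c (cs : k.-tuple coin) => P (cons_tuple c cs))
  (fun _ _ => 1%N)) /=.
by apply: eq_bigr => c _; rewrite -sum1_card; apply: eq_bigl => cs; rewrite inE.
Qed.

Lemma bad_probE (t : seq X) (m : M) :
  #|[set cs : (size t).-tuple coin |
      bad (foldl (fun m xc => step xc.2 m xc.1) m (zip t cs))]|%:R
    / #|{: (size t).-tuple coin}|%:R = bad_prob t m :> R.
Proof.
elim: t m => [|x t IH] m /=.
  rewrite card_tuple expn0 divr1; congr (_%:R).
  rewrite (_ : [set _ | _] = if bad m then finset.setT else finset.set0); last first.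
    by apply/setP => cs; rewrite inE tuple0 /=; case: (bad m); rewrite inE.
  by case: (bad m); rewrite ?cards0 ?cardsT ?card_tuple.
rewrite card_tuple_cons natr_sum mulr_suml [RHS]mulr_suml.
by apply: eq_bigr => c _; rewrite -IH !card_tuple expnS natrM invfM mulrA mulrAC.
Qed.

Lemma bad_prob_le1 (t : seq X) (m : M) : bad_prob t m <= 1.
Proof.
elim: t m => [|x t IH] m /=; first by rewrite lern1 leq_b1.
have [E|c0] := posnP #|coin|; first by rewrite E invr0 mulr0.
rewrite ler_pdivrMr ?ltr0n // mul1r -sum1_card natr_sum.
exact: ler_sum.
Qed.

(** A union bound over the first coin: coins in [P] cost at most 1 each, the others at most [b]. *)
Lemma bad_prob_step_le (P : pred coin) (a b : R) (x : X) (t : seq X) (m : M) :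
  (0 < #|coin|)%N -> 0 <= b -> #|[set c | P c]|%:R / #|coin|%:R <= a ->
  (forall c, ~~ P c -> bad_prob t (step c m x) <= b) ->
  bad_prob (x :: t) m <= a + b.
Proof.
move=> c0 b0 Pa Pb /=.
have c0R : 0 < #|coin|%:R :> R by rewrite ltr0n.
rewrite ler_pdivrMr // mulrDl; move: Pa; rewrite ler_pdivrMr // => Pa.
apply: (@le_trans _ _ (\sum_c ((P c)%:R + b))).
  apply: ler_sum => c _; case E: (P c); last by rewrite add0r Pb ?E.
  by rewrite -[leLHS]addr0 lerD // bad_prob_le1.
rewrite big_split /= sumr_const -[b *+ _]mulr_natr lerD2r -natr_sum.
apply: le_trans Pa; rewrite ler_nat -sum1_card [leqRHS]big_mkcond.
by apply: leq_sum => c _; rewrite inE; case: (P c).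
Qed.

Lemma bad_prob_step_const (x : X) (t : seq X) (m m' : M) :
  (0 < #|coin|)%N -> (forall c, step c m x = m') ->
  bad_prob (x :: t) m = bad_prob t m'.
Proof.
move=> c0 E /=; rewrite (eq_bigr (fun=> bad_prob t m')) => [|c _]; last by rewrite E.
by rewrite sumr_const -[_ *+ #|_|]mulr_natr mulfK // pnatr_eq0 -lt0n.
Qed.

End BadProbability.

(** [dec] is only ever applied to encodings, so the analysis can use structured states instead of
    bit words. *)
Lemma bad_prob_encode (R : realType) (coin : finType) (S M X : Type)
    (step : coin -> S -> X -> S) (bad : pred S) (enc : S -> M) (dec : M -> S)
    (t : seq X) (st : S) :
  cancel enc dec ->
  bad_prob R (fun c m x => enc (step c (dec m) x)) (fun m => bad (dec m)) t (enc st)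
    = bad_prob R step bad t st.
Proof.
move=> encK; elim: t st => [|x t IH] st /=; rewrite encK //.
by congr (_ / _); apply: eq_bigr.
Qed.

Arguments bad_prob : simpl never.

Lemma finite_encoding (S M : finType) : (#|S| <= #|M|)%N -> S ->
  exists (enc : S -> M) (dec : M -> S), cancel enc dec.
Proof.
move=> SM s0; exists (fun s => enum_val (widen_ord SM (enum_rank s))).
exists (fun m => nth s0 (enum S) (enum_rank m)) => s.
by rewrite enum_valK /= nth_enum_rank.
Qed.

(** Serves to show that a uniform number below a multiple of [d] has a uniform residue modulo
    [d]. *)
Lemma sum_modn (k d : nat) (F : nat -> nat) :
  (\sum_(i < k * d) F (i %% d) = k * \sum_(i < d) F i)%N.
Proof.
elim: k => [|k IH]; first by rewrite !mul0n big_ord0.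
rewrite mulSn addnC big_split_ord /= IH mulSn addnC; congr (_ + _)%N.
by apply: eq_bigr => i _; rewrite modnMDl modn_small.
Qed.

(** * Outdegrees in acyclic tournaments *)

Section Outdegree.
Context (n : nat) (e : rel 'I_n).

Definition outdeg (v : 'I_n) : nat := #|[set u | e v u]|.

Definition out_nbrs (s : seq ('I_n * 'I_n)) (v : 'I_n) : seq 'I_n :=
  [seq x.2 | x <- s & x.1 == v].

Lemma outdeg0_sink (v : 'I_n) : outdeg v = 0%N -> sink e v.
Proof.
move/eqP; rewrite cards_eq0 => /eqP E; apply/forallP => u.
by have := finset.in_set0 u; rewrite -E inE => ->.
Qed.

(** An out-neighbour of [v] that is not one of [u] would close a cycle of length 2 or 3; the
    inclusion is strict because of [v] itself. *)
Lemma outdeg_lt (u v : 'I_n) :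
  tournament e -> acyclic e -> e u v -> (outdeg v < outdeg u)%N.
Proof.
move=> [irr tot] acyc uv; apply/proper_card/properP; split; last first.
  by exists v; rewrite !inE ?irr.
apply/fintype.subsetP => w; rewrite !inE => vw; apply: contraT => uw.
have [E|uw'] := eqVneq u w.
  by have /acyc : cycle e [:: u; v] by rewrite /= uv E vw.
have := tot _ _ uw'; rewrite (negbTE uw) /= => wu.
by have /acyc : cycle e [:: u; v; w] by rewrite /= uv vw wu.
Qed.

Lemma outdeg_inj : tournament e -> acyclic e -> injective outdeg.
Proof.
move=> te ae u v E; apply/eqP; apply: contraT => uv.
have := te.2 _ _ uv; case euv: (e u v) => /=.
  by move: (outdeg_lt te ae euv); rewrite E ltnn.
by move/(outdeg_lt te ae); rewrite E ltnn.
Qed.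

Lemma outdeg_lt_card (v : 'I_n) : tournament e -> (outdeg v < n)%N.
Proof.
move=> [irr _]; rewrite -[ltnRHS]card_ord -cardsT; apply/proper_card/properP.
by split; [apply/fintype.subsetP => w; rewrite !inE | exists v; rewrite !inE ?irr].
Qed.

Context (s : seq ('I_n * 'I_n)) (es : edge_stream e s).

Lemma mem_out_nbrs (u v : 'I_n) : (u \in out_nbrs s v) = e v u.
Proof.
rewrite -es.2; apply/mapP/idP => [[[a b]]|vu].
  by rewrite mem_filter => /andP[/eqP /= -> ?] ->.
by exists (v, u) => //; rewrite mem_filter eqxx.
Qed.

Lemma uniq_out_nbrs (v : 'I_n) : uniq (out_nbrs s v).
Proof.
rewrite map_inj_in_uniq ?filter_uniq ?es.1 // => -[a b] [c d].
by rewrite !mem_filter => /andP[/eqP /= -> _] /andP[/eqP /= -> _] ->.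
Qed.

Lemma size_out_nbrs (v : 'I_n) : size (out_nbrs s v) = outdeg v.
Proof.
rewrite -(card_uniqP (uniq_out_nbrs v)).
by apply: eq_card => u; rewrite inE mem_out_nbrs.
Qed.

Lemma count_tail (v : 'I_n) : count (fun x => x.1 == v) s = outdeg v.
Proof. by rewrite -size_out_nbrs size_map size_filter. Qed.

End Outdegree.

(* The values of [f] on [l] are distinct and below [size l], so at most
   [size l - t <= size l * (1 - 1 / Q)] of them are at least [t]. *)
Lemma sample_bad_card (T : eqType) (f : T -> nat) (l : seq T) (x0 : T)
    (N m Q t : nat) :
  injective f -> uniq l -> {in l, forall x, (f x < size l)%N} ->
  (0 < size l)%N -> (size l %| N)%N -> (size l <= Q * t)%N ->
  (#|[set c : {ffun 'I_m -> 'I_N} |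
       [forall j, (t <= f (nth x0 l (c j %% size l)))%N]]| * Q ^ m
     <= (N * Q.-1) ^ m)%N.
Proof.
move=> f_inj l_uniq fl l0 /dvdnP[k kN] lQt.
pose B := [pred x : 'I_N | (t <= f (nth x0 l (x %% size l)))%N].
have -> : #|[set c : {ffun 'I_m -> 'I_N} |
    [forall j, (t <= f (nth x0 l (c j %% size l)))%N]]| = (#|B| ^ m)%N.
  rewrite -[X in (_ ^ X)%N](card_ord m) -card_ffun_on.
  by apply: eq_card => c; rewrite inE; apply/forallP/ffun_onP.
rewrite -expnMn; suff : (#|B| * Q <= N * Q.-1)%N by case: (m) => // m1; rewrite leq_exp2r.
have -> : #|B| = (k * count (fun x => (t <= f x)%N) l)%N.
  pose F i := if (t <= f (nth x0 l i))%N then 1%N else 0%N.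
  rewrite -sum1_count big_mkcond (big_nth x0) big_mkord -(sum_modn _ _ F) -kN.
  by rewrite -sum1_card big_mkcond.
rewrite kN -!mulnA leq_mul2l; apply/orP; right.
have cnt : (count (fun x => (t <= f x)%N) l <= size l - t)%N.
  rewrite -size_filter -(size_map f) -(size_iota t (size l - t)).
  apply: uniq_leq_size; first by rewrite map_inj_uniq // filter_uniq.
  move=> _ /mapP[x xl ->]; move: xl; rewrite mem_filter => /andP[tx /fl xl].
  rewrite mem_iota tx; lia.
apply: leq_trans (leq_mul cnt (leqnn Q)) _.
by rewrite mulnBl -subn1 mulnBr muln1 leq_sub2l // mulnC.
Qed.

Lemma sample_bad_prob (R : realType) (T : eqType) (f : T -> nat) (l : seq T) (x0 : T)
    (N m Q t : nat) :
  injective f -> uniq l -> {in l, forall x, (f x < size l)%N} ->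
  (0 < size l)%N -> (size l %| N)%N -> (size l <= Q * t)%N -> (0 < N)%N -> (0 < Q)%N ->
  #|[set c : {ffun 'I_m -> 'I_N} |
       [forall j, (t <= f (nth x0 l (c j %% size l)))%N]]|%:R
    / #|{ffun 'I_m -> 'I_N}|%:R <= (Q.-1%:R / Q%:R) ^+ m :> R.
Proof.
move=> f_inj l_uniq fl l0 lN lQt N0 Q0.
have := sample_bad_card x0 m f_inj l_uniq fl l0 lN lQt.
rewrite card_ffun !card_ord expr_div_n -!natrX ler_pdivrMr ?ltr0n ?expn_gt0 ?N0 //.
rewrite mulrAC ler_pdivlMr ?ltr0n ?expn_gt0 ?Q0 // -!natrM ler_nat.
by rewrite expnMn [(N ^ m * _)%N]mulnC.
Qed.

Lemma passesS (X : Type) (q : nat) (s : seq X) :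
  passes q.+1 s = None :: map Some s ++ passes q s.
Proof. by []. Qed.

(** * The algorithm on structured states *)

Section Algorithm.
Context (n m : nat) (v0 : 'I_n) (j0 : 'I_m).

Definition slots : Type := {ffun 'I_m -> 'I_n}.
Definition counters : Type := {ffun 'I_m -> 'I_n.+1}.
(** The kind of the current pass has to be remembered too. In a counting pass, [r j] is the number
    of edges leaving [u j] read so far. *)
Definition state : Type := option (slots * counters + 'I_n * slots * counters).

Notation Start := None (only parsing).
Notation Counting u r := (Some (inl (u, r))).
Notation Sampling v u r := (Some (inr (v, u, r))).

(* Every [d <= n] divides [n`!], so that residues modulo [d] of these ranks are
   uniformly distributed. *)
Definition ranks : Type := {ffun 'I_m -> 'I_(n`!)}.

Definition winner (r : counters) : 'I_m := arg_min j0 xpredT (fun j => r j : nat).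

(* In state [Sampling v u r], [u j] will be overwritten by the next [r j]
   out-neighbours of [v] to come. *)
Definition start_pass (c : ranks) (st : state) : state :=
  match st with
  | Start => Counting [ffun j => nth v0 (enum 'I_n) (c j %% size (enum 'I_n))] [ffun=> ord0]
  | Counting u r =>
    let i := winner r in
    Sampling (u i) [ffun=> u i] [ffun j => inord (c j %% r i).+1]
  | Sampling v u r => Counting u [ffun=> ord0]
  end.

Definition read_edge (st : state) (x : 'I_n * 'I_n) : state :=
  match st with
  | Start => Start
  | Counting u r =>
    Counting u [ffun j => if x.1 == u j then inord (r j).+1 else r j]
  | Sampling v u r =>
    if x.1 == v then
      Sampling v [ffun j => if r j == 0%N :> nat then u j else x.2]
        [ffun j => inord (r j).-1]
    else st
  end.

Definition read_item (c : ranks) (st : state) (x : option ('I_n * 'I_n)) : state :=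
  if x is Some y then read_edge st y else start_pass c st.

(** An odd number of passes ends in a counting state; [v0] is a dummy value elsewhere. *)
Definition guess (st : state) : 'I_n :=
  if st is Counting u r then u (winner r) else v0.

Lemma ranks_gt0 : (0 < #|{: ranks}|)%N.
Proof. by rewrite card_ffun card_ord expn_gt0 fact_gt0. Qed.

(** The hypothesis keeps every counter within ['I_n.+1], so that [inord] never falls back to its
    default. *)
Lemma read_counting (s : seq ('I_n * 'I_n)) (u : slots) (r : counters) :
  (forall j, (r j + count (fun x => x.1 == u j) s <= n)%N) ->
  foldl read_edge (Counting u r) s =
    Counting u [ffun j => inord (r j + count (fun x => x.1 == u j) s)].
Proof.
elim: s r => [|x s IH] r /= rn.
  by congr (Counting _ _); apply/ffunP => j; rewrite ffunE addn0 inord_val.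
have E j : nat_of_ord (if x.1 == u j then inord (r j).+1 else r j) = (r j + (x.1 == u j))%N.
  case: eqP (rn j) => _ rj; last by rewrite addn0.
  by rewrite inordK ?addn1 // ltnS; apply: leq_trans rj; rewrite add1n addnS ltnS leq_addr.
rewrite IH => [|j]; last by rewrite ffunE E -addnA.
by congr (Counting _ _); apply/ffunP => j; rewrite !ffunE E addnA.
Qed.

(** A slot is overwritten until its counter reaches 0 and is then frozen. The final counters can
    stay unspecified, as the next pass resets them. *)
Lemma read_sampling (s : seq ('I_n * 'I_n)) (v : 'I_n) (u : slots) (r : counters) :
  exists r', foldl read_edge (Sampling v u r) s =
    Sampling v [ffun j => last (u j) (take (r j) (out_nbrs s v))] r'.
Proof.
elim: s u r => [|[a b] s IH] u r /=.
  by exists r; congr (Sampling _ _ _); apply/ffunP => j; rewrite ffunE.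
rewrite /out_nbrs /=; case: eqP => _ /=; last exact: IH.
have [r' ->] := IH [ffun j => if r j == 0%N :> nat then u j else b] [ffun j => inord (r j).-1].
exists r'; congr (Sampling _ _ _); apply/ffunP => j; rewrite !ffunE.
rewrite inordK; last by apply: leq_ltn_trans (leq_pred _) (ltn_ord _).
by case: (nat_of_ord (r j)) => [|k]; rewrite ?take0.
Qed.

(** * Error analysis of the sampling rounds *)

Section Analysis.
Context (R : realType) (e : rel 'I_n) (s : seq ('I_n * 'I_n)).
Context (te : tournament e) (ae : acyclic e) (es : edge_stream e s).

Definition degrees (u : slots) : counters := [ffun j => inord (outdeg e (u j))].

Lemma degreesE (u : slots) (j : 'I_m) : degrees u j = outdeg e (u j) :> nat.
Proof. by rewrite ffunE inordK // ltnS ltnW // outdeg_lt_card. Qed.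

Lemma winner_le (u : slots) (j : 'I_m) :
  (outdeg e (u (winner (degrees u))) <= outdeg e (u j))%N.
Proof.
rewrite -!degreesE /winner.
by case: arg_minnP => // i _; apply.
Qed.

Lemma counting_pass (u : slots) :
  foldl read_edge (Counting u [ffun=> ord0]) s = Counting u (degrees u).
Proof.
rewrite read_counting => [|j]; rewrite ?ffunE ?add0n.
  by congr (Counting _ _); apply/ffunP => j; rewrite !ffunE add0n (count_tail es).
by rewrite (count_tail es) ltnW // outdeg_lt_card.
Qed.

Definition failure (t : seq (option ('I_n * 'I_n))) (st : state) : R :=
  bad_prob R read_item (fun st => ~~ sink e (guess st)) t st.

(** Edges are read without looking at the coin, so they act deterministically. *)
Lemma failure_edges (s' : seq ('I_n * 'I_n)) t st :
  failure (map Some s' ++ t) st = failure t (foldl read_edge st s').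
Proof.
elim: s' st => [|x s' IH] st //; rewrite [RHS]/= -IH.
by apply: bad_prob_step_const => //; apply: ranks_gt0.
Qed.

Lemma failure_count (v : 'I_n) (u : slots) (r : counters) q :
  failure (None :: map Some s ++ passes q s) (Sampling v u r) =
    failure (passes q s) (Counting u (degrees u)).
Proof.
rewrite -counting_pass -failure_edges.
by apply: bad_prob_step_const => //; apply: ranks_gt0.
Qed.

Context (Q : nat) (delta : R).
Hypotheses (Q0 : (0 < Q)%N) (Qdelta : (Q.-1%:R / Q%:R) ^+ m <= delta).

Lemma delta_ge0 : 0 <= delta.
Proof. by apply: le_trans Qdelta; rewrite exprn_ge0 // divr_ge0. Qed.

(** Each induction step spends a sampling and a counting pass and adds at most [delta]. For [j = 0]
    the least outdegree is below 1, so the winner is a sink. *)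
Lemma failure_counted (j : nat) (u : slots) :
  (exists i, (outdeg e (u i) < Q ^ j)%N) ->
  failure (passes (2 * j) s) (Counting u (degrees u)) <= j%:R * delta.
Proof.
elim: j u => [|j IH] u [i0 ui0].
  rewrite mul0r /failure /bad_prob /= outdeg0_sink //; apply/eqP.
  by rewrite -leqn0 -ltnS; apply: leq_ltn_trans (winner_le u i0) ui0.
have -> : (2 * j.+1 = (2 * j).+2)%N by lia.
rewrite !passesS.
set v := u (winner (degrees u)); set l := out_nbrs s v.
have vQ : (outdeg e v < Q ^ j.+1)%N := leq_ltn_trans (winner_le u i0) ui0.
have sl : size l = outdeg e v := size_out_nbrs es v.
(* Once [c] is fixed both passes are deterministic; the successor makes [take] end at index
   [c i %% size l] of [l]. *)
have after (c : ranks) :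
    failure (map Some s ++ None :: map Some s ++ passes (2 * j) s)
      (start_pass c (Counting u (degrees u))) =
    let u' : slots := [ffun i => last v (take (c i %% size l).+1 l)] in
    failure (passes (2 * j) s) (Counting u' (degrees u')).
  rewrite failure_edges /= degreesE -/v.
  have [r' ->] := read_sampling s v [ffun=> v]
    [ffun i => inord (c i %% outdeg e v).+1].
  rewrite failure_count.
  apply: (congr1 (fun w : slots => failure (passes (2 * j) s) (Counting w (degrees w)))).
  apply/ffunP => i; rewrite !ffunE -/l sl.
  have [d0|d0] := posnP (outdeg e v).
    by rewrite (size0nil (etrans sl d0)).
  rewrite inordK // !ltnS; apply: leq_trans (ltnW (outdeg_lt_card v te)).
  by rewrite ltn_mod.
(* If [v] is already the sink, [l] is empty and every slot keeps [v], so no coin is bad. *)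
have [d0|d0] := posnP (outdeg e v).
  rewrite -[leRHS]add0r -[failure _ _]/(bad_prob _ _ _ (None :: _) _).
  apply: (@bad_prob_step_le _ _ _ _ _ _ xpred0).
  - exact: ranks_gt0.
  - by rewrite mulr_ge0 // delta_ge0.
  - by rewrite eq_card0 ?mul0r // => c; rewrite inE.
  move=> c _; apply: le_trans (_ : j%:R * delta <= _); last first.
    by rewrite ler_wpM2r ?delta_ge0 // ler_nat.
  rewrite -[bad_prob _ _ _ _ _]/(failure _ _) after; apply: IH; exists j0.
  by rewrite ffunE (size0nil (etrans sl d0)) /= d0 expn_gt0 Q0.
rewrite -natr1 mulrDl mul1r [leRHS]addrC.
(* A coin is bad if all samples have outdegree at least [Q ^ j]; otherwise some slot meets the
   induction hypothesis. *)
apply: (@bad_prob_step_le _ _ _ _ _ _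
  (fun c : ranks => [forall i, (Q ^ j <= outdeg e (nth v l (c i %% size l)))%N])).
- exact: ranks_gt0.
- by rewrite mulr_ge0 // delta_ge0.
- apply: le_trans Qdelta; apply: sample_bad_prob => //.
  + exact: outdeg_inj.
  + exact: uniq_out_nbrs es v.
  + by move=> x; rewrite (mem_out_nbrs es) sl => /(outdeg_lt te ae).
  + by rewrite sl.
  + by rewrite sl dvdn_fact // d0 ltnW // outdeg_lt_card.
  + by rewrite sl -expnS ltnW.
  + exact: fact_gt0.
move=> c /forallPn[i]; rewrite -ltnNge => ci.
rewrite -[bad_prob _ _ _ _ _]/(failure _ _) after; apply: IH; exists i.
have cl : (c i %% size l < size l)%N by rewrite ltn_mod sl.
by rewrite ffunE (take_nth v) // last_rcons.
Qed.

(** The full vertex list acts as the out-neighbours of a virtual vertex of outdegree [n], so the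
    first round needs only a counting pass. *)
Lemma failure_start (p : nat) : (n <= Q ^ p.+1)%N ->
  failure (passes (2 * p.+1 - 1) s) Start <= p.+1%:R * delta.
Proof.
move=> nQ; have -> : (2 * p.+1 - 1 = (2 * p).+1)%N by lia.
have n0 : (0 < n)%N := leq_ltn_trans (leq0n v0) (ltn_ord v0).
rewrite passesS -natr1 mulrDl mul1r [leRHS]addrC.
apply: (@bad_prob_step_le _ _ _ _ _ _ (fun c : ranks =>
  [forall i, (Q ^ p <= outdeg e (nth v0 (enum 'I_n) (c i %% size (enum 'I_n))))%N])).
- exact: ranks_gt0.
- by rewrite mulr_ge0 // delta_ge0.
- apply: le_trans Qdelta; apply: sample_bad_prob; rewrite ?size_enum_ord //.
  + exact: outdeg_inj.
  + exact: enum_uniq.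
  + by move=> x _; rewrite outdeg_lt_card.
  + by rewrite dvdn_fact // n0 leqnn.
  + by rewrite -expnS.
  + exact: fact_gt0.
move=> c /forallPn[i]; rewrite -ltnNge => ci.
rewrite -[bad_prob _ _ _ _ _]/(failure (map Some s ++ passes (2 * p) s) _).
rewrite failure_edges /= counting_pass; apply: failure_counted; exists i.
by rewrite ffunE.
Qed.

End Analysis.
End Algorithm.

(** * Memory size and choice of parameters *)

Lemma card_state (n m : nat) : (1 < n)%N ->
  (#|{: state n m}| <= #|{: (3 * m + 3).-tuple ((up_log 2 n).-tuple bool)}|)%N.
Proof.
move=> n1; rewrite !card_tuple card_bool.
apply: (@leq_trans (n ^ (3 * m + 3))); last by rewrite leq_exp2r ?up_logP // addnS.
rewrite card_option card_sum !card_prod !card_ffun !card_ord -mulnA -mulSn.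
have E : (n ^ m * n.+1 ^ m <= n ^ (3 * m))%N.
  rewrite [(3 * m)%N]mulSn expnD leq_mul2l; apply/orP; right.
  rewrite expnM; case: (m) => // m1; rewrite leq_exp2r // expnS expn1; nia.
have A0 : (0 < n ^ (3 * m))%N by rewrite expn_gt0 ltnW.
rewrite expnD; set a := (n ^ (3 * m))%N in E A0 *; set b := (n ^ m * _)%N in E *.
(* There are [1 + n.+1 * b] states, at most [n.+2 * a] since [b <= a] and [1 <= a]. *)
have n3 : (n.+2 <= n ^ 3)%N by rewrite !expnS expn0; nia.
by apply: leq_trans (leq_mul (leqnn a) n3); nia.
Qed.

Lemma sampling_alg (R : realType) (n m Q p : nat) (delta : R) :
  (1 < n)%N -> (0 < m)%N -> (0 < Q)%N -> (0 < p)%N -> (n <= Q ^ p)%N ->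
  (Q.-1%:R / Q%:R) ^+ m <= delta ->
  exists A : stream_alg n (3 * m + 3) ('I_n * 'I_n) 'I_n,
    solves_sink_find_t (2 * p - 1) A (p%:R * delta).
Proof.
move=> n1 m0 Q0 p0 nQ Qd.
pose v0 : 'I_n := Ordinal (ltnW n1); pose j0 : 'I_m := Ordinal m0.
have [enc [dec encK]] := finite_encoding (card_state m n1) None.
pose st : memory n (3 * m + 3) -> state n m := dec.
pose step c (mem : memory n (3 * m + 3)) x : memory n (3 * m + 3) :=
  enc (read_item v0 j0 c (st mem) x).
exists (StreamAlg (ranks_gt0 n m) (enc None) step (fun mem => guess v0 j0 (st mem))).
move=> e s te ae es; rewrite /failure_prob /run /=.
have := bad_probE R step (fun mem => ~~ sink e (guess v0 j0 (st mem)))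
  (passes (2 * p - 1) s) (enc None).
move=> ->; rewrite (bad_prob_encode _ _ (fun st => ~~ sink e (guess v0 j0 st)) _ _ encK).
by case: p p0 nQ => // p _ nQ; apply: failure_start nQ.
Qed.

(** This is [ln 2 <= 1], from [ln (1 + y) <= y] at [y = 1]. *)
Lemma ln_le_log2 (R : realType) (x : R) : 1 <= x -> ln x <= log2 x.
Proof.
move=> x1; have l2 : 0 < ln 2 :> R by rewrite ln_gt0 // ltr1n.
rewrite ler_pdivlMr // ler_piMr ?ln_ge0 //.
by have := @le_ln1Dx R 1; rewrite -[1 + 1]/(2%:R); apply; lra.
Qed.

(** From [1 - 1/Q <= expR (- 1/Q)], raised to the power [m]. *)
Lemma exp_decay (R : realType) (Q m : nat) (x : R) :
  (0 < Q)%N -> 0 < x -> Q%:R * ln x <= m%:R -> (Q.-1%:R / Q%:R) ^+ m <= x^-1.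
Proof.
move=> Q0 x0 Qm; have QR : 0 < Q%:R :> R by rewrite ltr0n.
have -> : Q.-1%:R / Q%:R = 1 + - Q%:R^-1 :> R.
  by rewrite -subn1 natrB // mulrBl divff ?mul1r // gt_eqF.
apply: (@le_trans _ _ (expR (- Q%:R^-1) ^+ m)).
  rewrite lerXn2r ?nnegrE ?expR_ge0 ?expR_ge1Dx // subr_ge0.
  by rewrite invf_le1 // ler1n.
rewrite -expRM_natr -[x in leRHS]lnK ?posrE // -expRN ler_expR mulNr lerN2.
by rewrite mulrC ler_pdivlMr // mulrC.
Qed.

Lemma two_le_of_log2 (R : realType) (n p : nat) :
  (1 <= p)%N -> p%:R <= log2 (n%:R : R) -> (1 < n)%N.
Proof.
move=> p1; rewrite ltnNge; apply: contraTN => n1; rewrite -ltNge.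
(* For [n = 0] this relies on the default value [ln 0 = 0]. *)
have -> : log2 (n%:R : R) = 0.
  by case: n n1 => [|[|//]] _; rewrite /log2 (ln0 (lexx 0), ln1) mul0r.
by rewrite ltr0n.
Qed.

Theorem theorem4p1 (R : realType) :
  exists C : R, 0 < C /\
    forall n p : nat,
      (1 <= p)%N -> p%:R <= log2 (n%:R : R) ->
      exists (k : nat) (A : stream_alg n k ('I_n * 'I_n) 'I_n),
        k%:R <= C * (n%:R `^ (1 / p%:R) * log2 (3 * p%:R)) /\
        solves_sink_find_t (2 * p - 1) A (1 / 3 : R).
Proof.
(* With [m <= (q + 1) * L + 1 <= 2 * q * L + 1] and [1 <= q * L], the [3 * m + 3] words are at most
   [12 * q * L]. *)
exists 12; split=> // n p p1 pn.
have n1 := two_le_of_log2 p1 pn.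
have p0R : 0 < p%:R :> R by rewrite ltr0n.
set q := n%:R `^ (1 / p%:R); set L := log2 _.
have q1 : 1 <= q.
  by rewrite -(powRr0 n%:R); apply: ler_powR; rewrite ?ler1n ?(ltnW n1) // divr_ge0.
have pR1 : 1 <= p%:R :> R by rewrite ler1n.
have x1 : 1 <= 3 * p%:R :> R by lra.
have lnL : ln (3 * p%:R) <= L by apply: ln_le_log2.
have L1 : 1 <= L.
  rewrite ler_pdivlMr ?mul1r ?ln_gt0 ?ltr1n // ler_ln ?posrE //; lra.
have ln0 : 0 <= ln (3 * p%:R) :> R by rewrite ln_ge0.
(* Rounding up gives [Q ^ p >= n], and [m] is chosen so that each of the [p] rounds fails with
   probability at most [1 / (3 * p)]. *)
pose Q := (Num.truncn q).+1; pose m := (Num.truncn (Q%:R * ln (3 * p%:R) : R)).+1.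
have qQ : q <= Q%:R by rewrite ltW // truncnS_gt.
have Qq : Q%:R <= q + 1 by rewrite -[leLHS]natr1 lerD2r truncn_le; lra.
have mQ : Q%:R * ln (3 * p%:R) <= m%:R :> R by rewrite ltW // truncnS_gt.
have Qm : m%:R <= Q%:R * ln (3 * p%:R) + 1 :> R.
  by rewrite -[leLHS]natr1 lerD2r truncn_le mulr_ge0.
have nQ : (n <= Q ^ p)%N.
  rewrite -(ler_nat R) natrX; apply: le_trans (_ : q ^+ p <= _); last first.
    by rewrite lerXn2r ?nnegrE ?ler0n //; lra.
  by rewrite -powR_mulrn ?powR_ge0 // -powRrM div1r mulVf ?gt_eqF // powRr1.
have Q0 : (0 < Q)%N by [].
have m0 : (0 < m)%N by [].
have [A solA] := sampling_alg n1 m0 Q0 p1 nQ (exp_decay Q0 (lt_le_trans ltr01 x1) mQ).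
exists (3 * m + 3)%N, A; split; last first.
  rewrite (_ : 1 / 3 = p%:R * (3 * p%:R)^-1) //.
  by rewrite invfM mulrCA divff ?mulr1 ?div1r // gt_eqF.
rewrite natrD natrM.
have h1 : Q%:R * ln (3 * p%:R) <= (q + 1) * L by apply: ler_pM.
have h2 : (q + 1) * L <= 2 * (q * L) by nra.
have h3 : 1 <= q * L by nra.
lra.
Qed.
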